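(* Not every valid virtual isotopy sequence with classical end diagrams admits a valid virtual crossing realization. That is, there exists a virtual isotopy sequence $K_1\to K_2\to\dots\to K_n$ whose initial diagram $K_1$ and final diagram $K_n$ contain no virtual crossings, and which admits no valid virtual crossing realization.
   Context: A virtual link diagram is a finite collection of oriented closed curves generically immersed in the plane whose transverse double points are of two kinds: classical crossings (carrying over/under information) and virtual crossings (undecorated, drawn circled). A diagram is classical if it has no virtual crossings. The virtual moves are: the Reidemeister moves I, II, III on classical crossings; the moves vI, vII, vIII, which have the same underlying shape as I, II, III but with all crossings virtual; and the move v, a triangle move in which a strand with two consecutive virtual crossings is moved past a classical crossing. Triangle moves with two classical crossings and one virtual crossing (forbidden moves) are not allowed. A virtual isotopy sequence is a sequence of diagrams $K_1\to\dots\to K_n$ where each $K_i$ differs from $K_{i-1}$ by a single virtual move (and possibly a planar isotopy); ''valid'' is sometimes added for emphasis. Each crossing is named and followed through the sequence, from the move introducing it (or $K_1$) to the move removing it (or $K_n$). A virtual crossing realization of the sequence is an assignment of a sign ($+$ or $-$) to each virtual crossing throughout the sequence, i.e. a replacement of each virtual crossing, throughout its lifetime in the sequence, by a classical crossing of the chosen sign. It is valid if the resulting sequence is a sequence of valid classical (Reidemeister) moves: every vII move becomes a II move and every v or vIII move becomes a III move (vI moves always become I moves). *)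

(* Defs.v *)
From mathcomp Require Import all_boot.
From Stdlib Require Import Relation_Operators.

Set Implicit Arguments.
Unset Strict Implicit.
Unset Printing Implicit Defensive.

(******************************************************************************)
(* Diagrams are plane curves in Morse position, read from bottom to top and   *)
(* cut into horizontal slabs, each containing exactly one minimum, maximum or *)
(* double point, every other strand being vertical.  A strand is referred to  *)
(* by its position, counted from 0 at the left, below the slab in question.   *)
(* Every generic immersion in the plane of a finite family of circles is      *)
(* planar isotopic to one in Morse position, and planar isotopy of these is   *)
(* generated by the local changes listed in [planar_change].                  *)
(******************************************************************************)

(* The sign of a classical crossing is its usual local writhe with respect to *)
(* the orientation of the link: [true] is +, [false] is -.  Being invariant   *)
(* under planar isotopy, it is recorded in place of the over/under data,      *)
(* which [slash_over] recovers from it.                                       *)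
Inductive marking : Type := Virtual | Classical of bool.

Record crossing : Type := Crossing { name : nat; mark : marking }.

Definition is_virtual (c : crossing) : bool :=
  if mark c is Virtual then true else false.

(* [Cup i o] creates the strands i and i+1 from a minimum, the left one being *)
(* directed upwards iff [o]; [Cap i] joins strands i and i+1 in a maximum;    *)
(* [Cross i c] interchanges strands i and i+1 at the double point c.          *)
Inductive piece : Type :=
  | Cup of nat & bool
  | Cap of nat
  | Cross of nat & crossing.

Definition picture : Type := seq piece.

(* A level is the list of directions of the strands met by a horizontal line, *)
(* from left to right, [true] meaning upwards.                                *)
Definition pass (p : piece) (s : seq bool) : option (seq bool) :=
  match p with
  | Cup i o =>
      if i <= size s then Some (take i s ++ [:: o; ~~ o] ++ drop i s) else None
  | Cap i =>
      if (i.+1 < size s) && (nth true s i != nth true s i.+1)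
      then Some (take i s ++ drop i.+2 s) else None
  | Cross i _ =>
      if i.+1 < size s
      then Some (take i s ++ [:: nth true s i.+1; nth true s i] ++ drop i.+2 s)
      else None
  end.

Definition top_level (w : picture) : option (seq bool) :=
  foldl (fun s p => obind (pass p) s) (Some [::]) w.

Definition crossings (w : picture) : seq crossing :=
  pmap (fun p => if p is Cross _ c then Some c else None) w.

Definition names (w : picture) : seq nat := map name (crossings w).

Definition is_diagram (w : picture) : bool :=
  (top_level w == Some [::]) && uniq (names w).

Definition is_classical_diagram (w : picture) : bool :=
  is_diagram w && ~~ has is_virtual (crossings w).

(******************************************************************************)
(* Planar isotopy                                                             *)
(******************************************************************************)

Definition position (p : piece) : nat :=
  match p with Cup i _ => i | Cap i => i | Cross i _ => i end.

Definition move_to (j : nat) (p : piece) : piece :=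
  match p with Cup _ o => Cup j o | Cap _ => Cap j | Cross _ c => Cross j c end.

(* number of strands entering a piece from below, and leaving it above *)
Definition inputs (p : piece) : nat := if p is Cup _ _ then 0 else 2.
Definition outputs (p : piece) : nat := if p is Cap _ then 0 else 2.

(* The slides carry a double point around an extremum of one of its two       *)
(* branches, which turns it by a quarter turn.  In [Exchange] the piece q     *)
(* lies to the right of p.                                                    *)
Inductive planar_change : picture -> picture -> Prop :=
  | Zigzag_left i o : planar_change [:: Cup i o; Cap i.+1] [::]
  | Zigzag_right i o : planar_change [:: Cup i.+1 o; Cap i] [::]
  | Cup_slide i o c :
      planar_change [:: Cup i o; Cross i.+1 c] [:: Cup i.+1 o; Cross i c]
  | Cap_slide i c :
      planar_change [:: Cross i.+1 c; Cap i] [:: Cross i c; Cap i.+1]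
  | Exchange p q :
      position p + inputs p <= position q ->
      planar_change [:: q; p]
        [:: p; move_to (position q + outputs p - inputs p) q].

Definition planar_step (K K' : picture) : Prop :=
  is_diagram K /\ is_diagram K' /\
  exists u v l r,
    [/\ planar_change l r, K = u ++ l ++ v & K' = u ++ r ++ v].

Definition planar_isotopic : picture -> picture -> Prop :=
  clos_refl_sym_trans picture planar_step.

(******************************************************************************)
(* Moves                                                                      *)
(******************************************************************************)

(* The two shapes of kinks have their loop on the left, resp. right, of the   *)
(* strand.  Strand directions being arbitrary, these shapes cover, up to      *)
(* planar isotopy, all oriented versions of the three moves.                  *)
Inductive local_move : Type :=
  | R1_left of nat & bool & crossing
  | R1_right of nat & bool & crossing
  | R2 of nat & crossing & crossing
  | R3 of nat & crossing & crossing & crossing.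

Definition lhs (l : local_move) : picture :=
  match l with
  | R1_left i o c => [:: Cup i o; Cross i.+1 c; Cap i]
  | R1_right i o c => [:: Cup i.+1 o; Cross i c; Cap i.+1]
  | R2 i c d => [:: Cross i c; Cross i d]
  | R3 i a b c => [:: Cross i a; Cross i.+1 b; Cross i c]
  end.

Definition rhs (l : local_move) : picture :=
  match l with
  | R1_left _ _ _ => [::]
  | R1_right _ _ _ => [::]
  | R2 _ _ _ => [::]
  | R3 i a b c => [:: Cross i.+1 c; Cross i b; Cross i.+1 a]
  end.

(* A move applied inside a whole diagram, from [lhs] to [rhs] if [direct] and *)
(* from [rhs] to [lhs] otherwise.                                             *)
Record move : Type := Move {
  below : picture;
  local : local_move;
  above : picture;
  direct : bool
}.

Definition source (m : move) : picture :=
  below m ++ (if direct m then lhs (local m) else rhs (local m)) ++ above m.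

Definition target (m : move) : picture :=
  below m ++ (if direct m then rhs (local m) else lhs (local m)) ++ above m.

(* direction of strand i just below the place where the move happens *)
Definition direction (m : move) (i : nat) : bool :=
  nth true (odflt [::] (top_level (below m))) i.

(* At a crossing of sign [s] whose strands start, at the bottom, with         *)
(* directions [o1] on the left and [o2] on the right, whether the strand      *)
(* going from bottom left to top right is the over strand.  If both strands   *)
(* are directed upwards, this is what a positive crossing is; reversing one   *)
(* of the two strands changes the sign.                                       *)
Definition slash_over (o1 o2 s : bool) : bool := s == (o1 == o2).

(* In [R2], the same strand is over at both crossings.  In [R3], with strands *)
(* p, q, r from left to right at the bottom, a = pq, b = pr and c = qr are    *)
(* such that one of the strands is over the other two, equivalently the three *)
(* strands lie at different heights.                                          *)
Definition reidemeister_move (m : move) : bool :=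
  match local m with
  | R1_left _ _ c => ~~ is_virtual c
  | R1_right _ _ c => ~~ is_virtual c
  | R2 i c d =>
      let p := direction m i in
      let q := direction m i.+1 in
      match mark c, mark d with
      | Classical s, Classical t =>
          let p_over_q_at_c := slash_over p q s in
          let q_over_p_at_d := slash_over q p t in
          p_over_q_at_c == ~~ q_over_p_at_d
      | _, _ => false
      end
  | R3 i a b c =>
      let p := direction m i in
      let q := direction m i.+1 in
      let r := direction m i.+2 in
      match mark a, mark b, mark c with
      | Classical sa, Classical sb, Classical sc =>
          let p_over_q := slash_over p q sa in
          let p_over_r := slash_over p r sb in
          let q_over_r := slash_over q r sc in
          [|| p_over_q && p_over_r,
              ~~ p_over_q && q_over_r |
              ~~ p_over_r && ~~ q_over_r]
      | _, _, _ => false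
      end
  end.

(* vI, vII, v (exactly two of the three crossings virtual) and vIII *)
Definition purely_virtual_move (m : move) : bool :=
  match local m with
  | R1_left _ _ c => is_virtual c
  | R1_right _ _ c => is_virtual c
  | R2 _ c d => is_virtual c && is_virtual d
  | R3 _ a b c => 2 <= count is_virtual [:: a; b; c]
  end.

Definition virtual_move (m : move) : bool :=
  reidemeister_move m || purely_virtual_move m.

(******************************************************************************)
(* Isotopy sequences                                                          *)
(******************************************************************************)

(* The initial diagram, and for each later diagram the move leading to it. *)
Record sequence : Type := Sequence {
  initial : picture;
  steps : seq (move * picture)
}.

Definition diagrams (S : sequence) : seq picture :=
  initial S :: map snd (steps S).

Definition final (S : sequence) : picture := last [::] (diagrams S).

Fixpoint linked (allowed : pred move) (K : picture)
    (st : seq (move * picture)) : Prop :=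
  if st is (m, K') :: st' then
    [/\ planar_isotopic K (source m), allowed m, planar_isotopic (target m) K'
      & linked allowed K' st']
  else True.

(* A name designates one crossing: once its crossing has been removed, it is  *)
(* not used again.                                                            *)
Definition names_followed (Ks : seq picture) : Prop :=
  forall i j k n, i <= j -> j <= k -> k < size Ks ->
    n \in names (nth [::] Ks i) -> n \in names (nth [::] Ks k) ->
    n \in names (nth [::] Ks j).

Definition isotopy_sequence (allowed : pred move) (S : sequence) : Prop :=
  [/\ all is_diagram (diagrams S),
      linked allowed (initial S) (steps S)
    & names_followed (diagrams S)].

Definition virtual_isotopy_sequence : sequence -> Prop :=
  isotopy_sequence virtual_move.

Definition classical_isotopy_sequence : sequence -> Prop :=
  isotopy_sequence reidemeister_move.

(******************************************************************************)
(* Virtual crossing realizations                                              *)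
(******************************************************************************)

Definition realize_crossing (e : nat -> bool) (c : crossing) : crossing :=
  if is_virtual c then Crossing (name c) (Classical (e (name c))) else c.

Definition realize_piece (e : nat -> bool) (p : piece) : piece :=
  if p is Cross i c then Cross i (realize_crossing e c) else p.

Definition realize_picture (e : nat -> bool) (w : picture) : picture :=
  map (realize_piece e) w.

Definition realize_local (e : nat -> bool) (l : local_move) : local_move :=
  match l with
  | R1_left i o c => R1_left i o (realize_crossing e c)
  | R1_right i o c => R1_right i o (realize_crossing e c)
  | R2 i c d => R2 i (realize_crossing e c) (realize_crossing e d)
  | R3 i a b c =>
      R3 i (realize_crossing e a) (realize_crossing e b) (realize_crossing e c)
  end.

Definition realize_move (e : nat -> bool) (m : move) : move :=
  Move (realize_picture e (below m)) (realize_local e (local m))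
       (realize_picture e (above m)) (direct m).

Definition realize (e : nat -> bool) (S : sequence) : sequence :=
  Sequence (realize_picture e (initial S))
    [seq (realize_move e st.1, realize_picture e st.2) | st <- steps S].

(* [e] gives the sign chosen for the virtual crossing of each name; its       *)
(* values at other names are not used.                                        *)
Definition valid_realization (e : nat -> bool) (S : sequence) : Prop :=
  classical_isotopy_sequence (realize e S).

(* Main.v *)
Require Import Defs.
From mathcomp Require Import all_boot.
From Stdlib Require Import Relation_Operators.

Set Implicit Arguments.
Unset Strict Implicit.
Unset Printing Implicit Defensive.

(** The sequence starts and ends at the closure of the trivial braid on three
    strands x, y, z, all directed upwards.  In between, virtual crossings turn
    the braid into v1 v2 v1 v2 v1 v2, in which first x passes y and z, then y
    passes z and x, and finally z passes x and y.  Just before one strand, say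
    x, passes the other two, a type II move makes y and z cross classically
    twice; type v moves push both crossings past x, and another type II move
    removes them.  This is done once with y over z and once with z over y.
    Finally the virtual crossings are removed in the way they were created.

    The six virtual crossings are born from three type vII moves, each
    producing both crossings of one pair of strands.  In a realization each
    pair of strands therefore has a well-defined higher member, the same at
    both of its virtual crossings.  When a classical crossing of y and z is
    pushed past x, x cannot lie under the upper and over the lower of these two
    strands.  Since both classical crossings occur, x is over both y and z or
    under both ([passing_forces_equal_signs]).  In the same way y is over both
    z and x or under both, and so is z with x and y.  But of the three relations
    x over y, y over z, z over x, two must agree, say the first two, and then y
    is neither over nor under both z and x: no realization is valid. *)

(** * Sequences given by their moves *)

Definition run (ms : seq move) : seq (move * picture) :=
  [seq (m, target m) | m <- ms].

Fixpoint composable (K : picture) (ms : seq move) : Prop :=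
  if ms is m :: ms' then K = source m /\ composable (target m) ms' else True.

Lemma linked_run (allowed : pred move) (K : picture) (ms : seq move) :
  composable K ms -> all allowed ms -> linked allowed K (run ms).
Proof.
elim: ms K => [//|m ms IHms] K /= [-> composable_ms].
case/andP=> allowed_m allowed_ms.
by split; [exact: rst_refl | | exact: rst_refl | exact: IHms].
Qed.

Lemma linked_allowed (allowed : pred move) (K : picture)
    (st : seq (move * picture)) :
  linked allowed K st -> all allowed [seq x.1 | x <- st].
Proof.
elim: st K => [//|[m K'] st IHst] K /= [_ -> _ linked_st].
exact: IHst linked_st.
Qed.

Lemma realization_moves (e : nat -> bool) (K : picture) (ms : seq move) :
  valid_realization e (Sequence K (run ms)) ->
  all (fun m => reidemeister_move (realize_move e m)) ms.
Proof. by case=> _ /linked_allowed; rewrite /= -!map_comp all_map. Qed.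

(** A boolean test, so that the names in the explicit sequence can be checked by
    evaluation. *)
Definition names_followedb (Ks : seq picture) : bool :=
  all (fun k => all (fun j => all (fun i =>
    all (fun n => (n \in names (nth [::] Ks k)) ==>
                  (n \in names (nth [::] Ks j)))
        (names (nth [::] Ks i)))
    (iota 0 j.+1)) (iota 0 k.+1)) (iota 0 (size Ks)).

Lemma names_followedP (Ks : seq picture) :
  names_followedb Ks -> names_followed Ks.
Proof.
move=> /allP followed i j k n le_ij le_jk lt_k n_i n_k.
have /followed/allP/(_ j) : k \in iota 0 (size Ks) by rewrite mem_iota.
rewrite mem_iota ltnS => /(_ le_jk)/allP/(_ i).
by rewrite mem_iota ltnS => /(_ le_ij)/allP/(_ n n_i)/implyP/(_ n_k).
Qed.

(** * Moves in the closure of a braid on three strands *)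

Definition cups : picture := [:: Cup 0 true; Cup 1 true; Cup 2 true].
Definition caps : picture := [:: Cap 2; Cap 1; Cap 0].

Definition braid_level : seq bool :=
  [:: true; true; true; false; false; false].

Definition braid_move (u : picture) (l : local_move) (v : picture) (d : bool) :
  move := Move (cups ++ u) l (v ++ caps) d.

Definition reverse_move (m : move) : move :=
  Move (below m) (local m) (above m) (~~ direct m).

Definition virtual (n : nat) : crossing := Crossing n Virtual.
Definition classical (n : nat) (s : bool) : crossing :=
  Crossing n (Classical s).

(** The leftmost strand passes the other two at [p] and [q].  Between the two
    type v moves these other strands have changed places, so that [q] is then
    met before [p]. *)
Definition passing (u : picture) (p q : nat) (v : picture) (n : nat)
    (s : bool) : seq move :=
  let P := virtual p in
  let Q := virtual q in
  let C := classical n s in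
  let D := classical n.+1 (~~ s) in
  [:: braid_move u (R2 1 C D) ([:: Cross 0 P; Cross 1 Q] ++ v) false;
      braid_move (u ++ [:: Cross 1 C]) (R3 0 Q P D) v false;
      braid_move u (R3 0 P Q C) (Cross 0 D :: v) false;
      braid_move (u ++ [:: Cross 0 P; Cross 1 Q]) (R2 0 C D) v true].

Definition passings (u : picture) (p q : nat) (v : picture) (n : nat) :
  seq move := passing u p q v n true ++ passing u p q v n.+2 false.

(** Of the signs of [p] and [q], a type v move excludes only those that put the
    passing strand under the upper and over the lower of the other two strands.
    All strands being directed upwards, these signs are different.  Of the two
    ways in which they can differ, each is excluded by one of the two orders of
    the strands being passed. *)
Lemma passing_forces_equal_signs (e : nat -> bool) (u : picture) (p q : nat)
    (v : picture) (n : nat) :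
  all (fun m => reidemeister_move (realize_move e m)) (passings u p q v n) ->
  top_level (realize_picture e (cups ++ u)) = Some braid_level ->
  e p = e q.
Proof.
(* The third move of each passing has the level of [u] at its bottom. *)
rewrite all_cat => /andP[/and5P[_ _ pass_pos _ _] /and5P[_ _ pass_neg _ _]].
move=> level_u; move: pass_pos pass_neg.
rewrite /reidemeister_move /direction [below _]/(realize_picture e (cups ++ u)).
by rewrite level_u /=; case: (e p); case: (e q).
Qed.

(** The strand that is over at both crossings comes from the left at one of them
    and from the right at the other. *)
Lemma birth_forces_opposite_signs (e : nat -> bool) (u : picture) (i p q : nat)
    (v : picture) :
  reidemeister_move
    (realize_move e (braid_move u (R2 i (virtual p) (virtual q)) v false)) ->
  top_level (realize_picture e (cups ++ u)) = Some braid_level -> i < 2 ->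
  e q = ~~ e p.
Proof.
rewrite /reidemeister_move /direction.
rewrite [below _]/(realize_picture e (cups ++ u)) => birth level_u lt_i2.
move: birth; rewrite level_u; case: i lt_i2 => [|[|//]] _ /=;
  by case: (e p); case: (e q).
Qed.

(** * The sequence *)

(** The virtual crossings of x and y are 0 and 3, those of x and z are 1 and 4,
    and those of y and z are 2 and 5. *)
Definition three_births : seq move :=
  [:: braid_move [::] (R2 0 (virtual 0) (virtual 3)) [::] false;
      braid_move [:: Cross 0 (virtual 0)] (R2 1 (virtual 1) (virtual 4))
        [:: Cross 0 (virtual 3)] false;
      braid_move [:: Cross 0 (virtual 0); Cross 1 (virtual 1)]
        (R2 0 (virtual 2) (virtual 5))
        [:: Cross 1 (virtual 4); Cross 0 (virtual 3)] false].

(** The births give a half twist followed by its inverse, and in both of them y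
    crosses one of x and z before, and the other after, these two cross.  The
    type vIII move rearranges the inverse so that y passes z and x
    consecutively, and each strand gets its turn as the leftmost one. *)
Definition preparation : seq move :=
  three_births ++
  [:: braid_move
        [:: Cross 0 (virtual 0); Cross 1 (virtual 1); Cross 0 (virtual 2)]
        (R3 0 (virtual 5) (virtual 4) (virtual 3)) [::] true].

Definition x_passes : picture := [:: Cross 0 (virtual 0); Cross 1 (virtual 1)].
Definition y_passes : picture := [:: Cross 0 (virtual 2); Cross 1 (virtual 3)].
Definition z_passes : picture := [:: Cross 0 (virtual 4); Cross 1 (virtual 5)].

Definition sequence_moves : seq move :=
  preparation
  ++ passings [::] 0 1 (y_passes ++ z_passes) 6
  ++ passings x_passes 2 3 z_passes 10
  ++ passings (x_passes ++ y_passes) 4 5 [::] 14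
  ++ [seq reverse_move m | m <- rev preparation].

Definition unrealizable_sequence : sequence :=
  Sequence (cups ++ caps) (run sequence_moves).

Lemma unrealizable_sequence_virtual :
  virtual_isotopy_sequence unrealizable_sequence.
Proof.
split; first by vm_compute.
- apply: linked_run; last by vm_compute.
  by vm_compute; repeat split.
- by apply: names_followedP; vm_compute.
Qed.

Lemma unrealizable_sequence_no_realization (e : nat -> bool) :
  ~ valid_realization e unrealizable_sequence.
Proof.
move=> /realization_moves; rewrite all_cat.
case/andP=> /and4P[birth_xy birth_xz birth_yz _].
rewrite all_cat => /andP[x_pass]; rewrite all_cat => /andP[y_pass].
rewrite all_cat => /andP[z_pass _].
have e3 := birth_forces_opposite_signs birth_xy erefl isT.
have e4 := birth_forces_opposite_signs birth_xz erefl isT.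
have e5 := birth_forces_opposite_signs birth_yz erefl isT.
have e01 := passing_forces_equal_signs x_pass erefl.
have e23 := passing_forces_equal_signs y_pass erefl.
have e45 := passing_forces_equal_signs z_pass erefl.
by move: e23 e45; rewrite e3 e4 e5 e01; case: (e 1); case: (e 2).
Qed.

Theorem theorem1 :
  exists S : sequence,
    [/\ virtual_isotopy_sequence S,
        is_classical_diagram (initial S),
        is_classical_diagram (final S)
      & ~ exists e : nat -> bool, valid_realization e S].
Proof.
exists unrealizable_sequence; split=> //.
- exact: unrealizable_sequence_virtual.
- by case=> e /unrealizable_sequence_no_realization.
Qed.
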